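(* Let $G$ be a connected non-complete graph of order $n\geq 33$. If $C(G)$ is a linear forest and $\deg(x)+\deg(y)\geq \frac{2n-9}{5}$ for each pair of non-adjacent vertices $x$ and $y$ of $G$, then $cfc(G) = 2$.
   Context: All graphs are finite, simple and undirected; $\deg(x)$ is the degree of $x$ in $G$. For a graph $G$, $C(G)$ denotes the subgraph of $G$ induced by the set of cut-edges of $G$. A linear forest is a forest each of whose components is a path (an edgeless graph counts). An edge-coloring of a connected graph (adjacent edges may receive the same color) is a conflict-free connection coloring if every pair of distinct vertices is joined by a path containing at least one color used on exactly one edge of that path. The conflict-free connection number $cfc(G)$ is the smallest number of colors in a conflict-free connection coloring of $G$. *)

(* Defs.v *)
From mathcomp Require Import all_boot all_order all_algebra.

Set Implicit Arguments.
Unset Strict Implicit.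
Unset Printing Implicit Defensive.

Record sgraph := SGraph {
  vertex :> finType;
  adj : rel vertex;
  adj_sym : symmetric adj;
  adj_irrefl : irreflexive adj
}.

Definition deg (G : sgraph) (x : G) : nat := #|[set y | adj x y]|.

Definition connected (G : sgraph) : Prop := forall x y : G, connect (@adj G) x y.

Definition complete (G : sgraph) : Prop := forall x y : G, x != y -> adj x y.

Definition del_edge (G : sgraph) (x y : G) : rel G :=
  fun u v => adj u v && ([set u; v] != [set x; y]).

(* The number of connected components increases when the edge is deleted. *)
Definition cut_edge (G : sgraph) : rel G :=
  fun x y => adj x y && (n_comp (@adj G) G < n_comp (del_edge x y) G).

Lemma cut_edge_sym (G : sgraph) : symmetric (@cut_edge G).
Proof.
move=> x y; rewrite /cut_edge adj_sym; congr (_ && (_ < _)).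
apply: eq_n_comp; apply: eq_connect => u v.
by rewrite /del_edge [[set y; x]]setUC.
Qed.

(* C(G): the vertices are the ends of cut-edges, the edges are the cut-edges. *)
Definition cut_vertex_type (G : sgraph) : finType :=
  {x : G | [exists y, cut_edge x y]}.

Definition cut_adj (G : sgraph) : rel (cut_vertex_type G) :=
  fun u v => cut_edge (val u) (val v).

Lemma cut_adj_sym (G : sgraph) : symmetric (@cut_adj G).
Proof. by move=> u v; rewrite /cut_adj cut_edge_sym. Qed.

Lemma cut_adj_irrefl (G : sgraph) : irreflexive (@cut_adj G).
Proof. by move=> u; rewrite /cut_adj /cut_edge adj_irrefl. Qed.

Definition cut_edge_graph (G : sgraph) : sgraph :=
  SGraph (@cut_adj_sym G) (@cut_adj_irrefl G).

Definition forest (G : sgraph) : Prop :=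
  forall s : seq G, 2 < size s -> uniq s -> ~~ cycle (@adj G) s.

(* s enumerates the component of x, and two of its vertices are adjacent
   exactly when they are consecutive in s. *)
Definition component_is_path (G : sgraph) (x : G) : Prop :=
  exists s : seq G,
    [/\ uniq s,
        s =i connect (@adj G) x &
        forall i j : nat, i < size s -> j < size s ->
          adj (nth x s i) (nth x s j) = (j == i.+1) || (i == j.+1)].

Definition linear_forest (G : sgraph) : Prop :=
  forest G /\ forall x : G, component_is_path x.

Definition simple_path (G : sgraph) (x y : G) (p : seq G) : Prop :=
  [/\ path (@adj G) x p, last x p = y & uniq (x :: p)].

Definition path_edges (G : sgraph) (x : G) (p : seq G) : seq {set G} :=
  pairmap (fun u v => [set u; v]) x p.

(* An edge-coloring is a function on vertex sets of which only the values on
   the sets [set u; v] with adj u v matter. *)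
Definition conflict_free_path (G : sgraph) (c : {set G} -> nat)
    (x : G) (p : seq G) : Prop :=
  exists a : nat, count (fun e => c e == a) (path_edges x p) = 1.

Definition cfc_coloring (G : sgraph) (c : {set G} -> nat) : Prop :=
  forall x y : G, x != y ->
    exists2 p : seq G, simple_path x y p & conflict_free_path c x p.

Definition cfc_colorable (G : sgraph) (k : nat) : Prop :=
  exists c : {set G} -> nat,
    (forall x y : G, adj x y -> c [set x; y] < k) /\ cfc_coloring c.

(* cfc(G) = k *)
Definition cfc_eq (G : sgraph) (k : nat) : Prop :=
  cfc_colorable G k /\ forall j : nat, cfc_colorable G j -> k <= j.

(* Main.v *)
Require Import Defs.
From mathcomp Require Import all_boot all_order all_algebra.
From mathcomp Require Import zify lra.

(* Let T be a spanning tree. Colour the edges outside T, and at most one bridge e0,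
   with the second colour. For x <> y consider the T-path from x to y. If it contains
   e0, it is conflict-free. If it contains a non-bridge e, exchanging e for an edge
   outside T that reconnects T - e gives a path with exactly one edge outside T, and it
   still avoids e0. Otherwise it consists of bridges different from e0, and it is a
   single edge as soon as those bridges form a matching.

   The degree condition leaves at most three bridges. Removing four of them would
   leave five parts; let v_i be a vertex of the i-th part with the fewest ends of
   removed bridges. Either v_i has no end, and its degree is less than the size of the
   part, or its degree is at most the number of ends in the part. As there are eight
   ends in all, the degree sums of non-adjacent v_i, v_j contradict n >= 33. Three
   bridges in a linear forest become a matching after removing a suitable one. *)

Set Implicit Arguments.
Unset Strict Implicit.
Unset Printing Implicit Defensive.

(** * Arithmetic of the five parts *)

(* [k i], [t i]: number of vertices and of bridge ends in the i-th of five parts of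
   G minus four bridges (8 ends in all); [d i]: degree of the vertex with the fewest
   ends in that part; [z i]: that vertex has no end. *)
Lemma five_parts n (k d t : nat -> nat) (z : nat -> bool) :
    33 <= n -> k 0 + (k 1 + (k 2 + (k 3 + (k 4 + 0)))) <= n ->
    t 0 + (t 1 + (t 2 + (t 3 + (t 4 + 0)))) <= 8 ->
    (forall i, i < 5 -> 0 < k i) -> (forall i, i < 5 -> 0 < t i) ->
    (forall i, if z i then d i < k i else d i <= t i) ->
    let ok i j := 2 * n <= 5 * (d i + d j) + 9 in
    (forall i j, i < j < 5 -> z i || z j -> ok i j) ->
    (forall i j l, i < j < l -> l < 5 -> [|| ok i j, ok j l | ok i l]) ->
  False.
Proof.
move=> n33 sumk sumt kpos tpos dP ok ok2 ok3.
(* If [z] fails on all three, [d] is at most [t] there. Any two values of [t] sum to at most 5,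
   since the other three are positive, and 5 * 5 + 9 < 2 * 33. *)
have no3 i j l : i < j < l -> l < 5 -> [|| z i, z j | z l].
  move=> ijl l5; have := ok3 i j l ijl l5; have := (dP i, dP j, dP l).
  have tle a b : a < b < 5 -> t a + t b <= 5.
    move=> ab; have := (tpos 0 isT, tpos 1 isT, tpos 2 isT, tpos 3 isT, tpos 4 isT).
    move: a b ab => [|[|[|[|[|a]]]]] [|[|[|[|[|b]]]]] ab [[[[? ?] ?] ?] ?]; try lia.
  have := (tle i j, tle j l, tle i l).
  rewrite /ok; case: (z i); case: (z j); case: (z l) => //= -[[t1 t2] t3] [[? ?] ?].
  have := (t1 ltac:(lia), t2 ltac:(lia), t3 ltac:(lia)) => -[[? ?] ?]; lia.
have [[[[? ?] ?] ?] ?] := (kpos 0 isT, kpos 1 isT, kpos 2 isT, kpos 3 isT, kpos 4 isT).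
have [[[[? ?] ?] ?] ?] := (tpos 0 isT, tpos 1 isT, tpos 2 isT, tpos 3 isT, tpos 4 isT).
have [[[[? ?] ?] ?] ?] := (no3 0 1 2 isT isT, no3 0 1 3 isT isT, no3 0 1 4 isT isT,
  no3 0 2 3 isT isT, no3 0 2 4 isT isT).
have [[[[? ?] ?] ?] ?] := (no3 0 3 4 isT isT, no3 1 2 3 isT isT, no3 1 2 4 isT isT,
  no3 1 3 4 isT isT, no3 2 3 4 isT isT).
have [[[[? ?] ?] ?] ?] := (dP 0, dP 1, dP 2, dP 3, dP 4).
have [[[[? ?] ?] ?] ?] := (ok2 0 1 isT, ok2 0 2 isT, ok2 0 3 isT, ok2 0 4 isT,
  ok2 1 2 isT).
have [[[[? ?] ?] ?] ?] := (ok2 1 3 isT, ok2 1 4 isT, ok2 2 3 isT, ok2 2 4 isT,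
  ok2 3 4 isT).
clear kpos tpos no3 dP ok2 ok3; subst ok; cbv beta in *.
(* The tight case has [z] on three parts. One of the other two has [t] at most 2, so the three
   degrees are at least (2n - 19) / 5 each, but they sum to at most n - 5; hence n <= 32. *)
destruct (z 0), (z 1), (z 2), (z 3), (z 4); cbn [orb] in *; try discriminate;
  repeat match goal with
  | H : is_true true -> _ |- _ => specialize (H isT)
  | H : is_true false -> _ |- _ => clear H
  end; lia.
Qed.

(** * Paths in spanning subgraphs *)

Section SpanningSubgraphs.

Variable G : sgraph.
Implicit Types (x y u v w : G) (p q : seq G) (e : {set G}) (E B T : {set {set G}}).

(** Edges are vertex sets, as in the colorings. Members of [E] that are not edges of G have no
    effect, so [setT] and [~: B] can serve as edge sets. *)
Definition span E : rel G := fun u v => adj u v && ([set u; v] \in E).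

Definition bridges : {set {set G}} :=
  [set e | [exists u, exists v, cut_edge u v && (e == [set u; v])]].

Lemma span_sym E : symmetric (span E).
Proof. by move=> u v; rewrite /span adj_sym setUC. Qed.

Lemma connect_span_sym E : connect_sym (span E).
Proof. exact/sym_connect_sym/span_sym. Qed.

Lemma connect_span_mono E E' x y :
  E \subset E' -> connect (span E) x y -> connect (span E') x y.
Proof.
move=> /subsetP sEE'; apply: connect_sub => u v /andP[uv uvE].
by apply: connect1; rewrite /span uv sEE'.
Qed.

Lemma path_span E x p :
  path (span E) x p = path (@adj G) x p && all (mem E) (path_edges x p).
Proof.
elim: p x => //= y p IHp x; rewrite IHp /span /=.
by case: (adj x y); rewrite //= andbCA.
Qed.

Lemma path_edges_cat x p q :
  path_edges x (p ++ q) = path_edges x p ++ path_edges (last x p) q.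
Proof. exact: pairmap_cat. Qed.

Lemma path_edges_sub x p e : e \in path_edges x p -> {subset e <= x :: p}.
Proof.
elim: p x => //= y p IHp x; rewrite inE => /orP[/eqP-> z|/IHp ep z ze].
  by rewrite !inE => /orP[]->; rewrite ?orbT.
by rewrite inE ep ?orbT.
Qed.

Lemma path_edges_uniq x p : uniq (x :: p) -> uniq (path_edges x p).
Proof.
elim: p x => //= y p IHp x /andP[xNp up]; rewrite IHp // andbT.
by apply: contra xNp => /path_edges_sub; apply; rewrite !inE eqxx.
Qed.

Lemma path_edges_split x p e : e \in path_edges x p ->
  exists p1 v p2, p = p1 ++ v :: p2 /\ e = [set last x p1; v].
Proof.
elim: p x => //= y p IHp x; rewrite inE => /orP[/eqP->|/IHp[p1 [v [p2 [-> ->]]]]].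
  by exists [::], y, p.
by exists (y :: p1), v, p2.
Qed.

Lemma connect_simple E x y : connect (span E) x y ->
  exists p, [/\ path (span E) x p, last x p = y & uniq (x :: p)].
Proof. by case/connectP=> p /shortenP[q qP uq _] ->; exists q. Qed.

Lemma path_span_del E x p e :
  path (span E) x p -> e \notin path_edges x p -> path (span (E :\ e)) x p.
Proof.
rewrite !path_span => /andP[-> /allP pE] eNp; apply/allP => f fp /=.
have fE : f \in E := pE f fp.
by rewrite !inE fE andbT; apply: contraNneq eNp => <-.
Qed.

Lemma path_span_split E x p e :
    path (span E) x p -> uniq (x :: p) -> e \in path_edges x p ->
  exists u v, [/\ e = [set u; v], span E u v, connect (span (E :\ e)) x u
    & connect (span (E :\ e)) v (last x p)].
Proof.
move=> pP /path_edges_uniq up /path_edges_split[p1 [v [p2 [pE eE]]]].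
move: pP up; rewrite pE path_edges_cat cat_path /= cat_uniq /= -eE.
case/and3P=> p1P uv p2P /and4P[_ + e2 _]; rewrite negb_or => /andP[e1 _].
exists (last x p1), v; split=> //.
  by apply/connectP; exists p1 => //; apply: path_span_del.
by apply/connectP; exists p2; rewrite ?last_cat //; apply: path_span_del.
Qed.

(** * Bridges as separating edges *)

Definition separating E e :=
  forall u v, e = [set u; v] -> ~~ connect (span (E :\ e)) u v.

(** A simple path uses [e] once, so its two remaining pieces lead to the two ends of [e]. A
    connection avoiding [e] would join these ends. *)
Lemma path_separating E x p e :
    path (span E) x p -> uniq (x :: p) -> e \in path_edges x p ->
  separating E e -> ~~ connect (span (E :\ e)) x (last x p).
Proof.
move=> pP up ep sepe; have [u [v [eE _ xu vy]]] := path_span_split pP up ep.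
apply: contra (sepe _ _ eE) => xy; rewrite connect_span_sym in xu.
apply: connect_trans xu (connect_trans xy _).
by rewrite connect_span_sym.
Qed.

Lemma connect_crossing (r : rel G) (A : {pred G}) x y :
  connect r x y -> x \in A -> y \notin A ->
  exists a b, [/\ r a b, a \in A & b \notin A].
Proof.
case/connectP=> p; elim: p x => [|z p IHp] x /= pP yE xA; first by rewrite yE xA.
case/andP: pP => xz zP yA; have [zA|zA] := boolP (z \in A); first exact: IHp yE zA yA.
by exists x, z.
Qed.

Lemma set2_eq u v u' v' : [set u; v] = [set u'; v'] ->
  (u = u' /\ v = v') \/ (u = v' /\ v = u').
Proof.
move=> eE.
have : u \in [set u'; v'] by rewrite -eE set21.
have : v \in [set u'; v'] by rewrite -eE set22.
have : u' \in [set u; v] by rewrite eE set21.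
have : v' \in [set u; v] by rewrite eE set22.
rewrite !inE; do 4!case/orP=> /eqP ?; subst; auto.
Qed.

Lemma connect_set2 (r : rel G) u v u' v' : connect_sym r ->
  [set u; v] = [set u'; v'] -> connect r u v = connect r u' v'.
Proof. by move=> rs /set2_eq[[-> ->]|[-> ->]]. Qed.

Lemma del_edgeE x y : del_edge x y =2 span (setT :\ [set x; y]).
Proof. by move=> u v; rewrite /del_edge /span !inE andbT. Qed.

Lemma connect_setT x y : connected G -> connect (span setT) x y.
Proof.
move=> conG; rewrite (@eq_connect _ _ (@adj G)) ?conG // => u v.
by rewrite /span inE andbT.
Qed.

(** If x and y stay connected, the components do not change. Otherwise their roots represent two
    components, while the connected G has one. *)
Lemma cut_edgeP x y : connected G -> adj x y ->
  cut_edge x y = ~~ connect (span (setT :\ [set x; y])) x y.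
Proof.
move=> conG xy; rewrite /cut_edge xy /=.
rewrite [X in _ < X](eq_n_comp (eq_connect (del_edgeE x y))).
set r := span _; have rs : connect_sym r by exact: connect_span_sym.
have adjs : connect_sym (@adj G) by exact/sym_connect_sym/adj_sym.
apply/idP/idP => [|xNy].
  apply: contraL => rxy; rewrite -leqNgt leq_eqVlt; apply/orP; left; apply/eqP.
  apply: eq_n_comp => u v; apply/idP/idP; last first.
    apply: connect_sub => a b ab; have [abE|abN] := eqVneq [set a; b] [set x; y].
      by rewrite (connect_set2 rs abE).
    by apply: connect1; rewrite /r /span ab !inE abN.
  by apply: connect_sub => a b /andP[ab _]; apply: connect1.
have -> : n_comp (@adj G) G = 1.
  rewrite -(n_comp_connect adjs x); apply: eq_n_comp_r => z.
  by rewrite !inE; apply/esym/conG.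
have rxyN : fingraph.root r x != fingraph.root r y by rewrite (root_connect rs).
apply/card_gt1P; exists (fingraph.root r x), (fingraph.root r y).
by rewrite !inE !roots_root.
Qed.

Lemma bridges_separating e : connected G -> e \in bridges -> separating setT e.
Proof.
move=> conG; rewrite inE => /existsP[u /existsP[v /andP[uv /eqP->]]] u' v' eE.
rewrite -(connect_set2 _ eE); last exact: connect_span_sym.
by rewrite -cut_edgeP //; case/andP: uv.
Qed.

Lemma bridges_connect u v : connected G -> adj u v -> [set u; v] \notin bridges ->
  connect (span (setT :\ [set u; v])) u v.
Proof.
move=> conG uv; apply: contraR => uvN; rewrite inE.
by apply/existsP; exists u; apply/existsP; exists v; rewrite cut_edgeP // uvN eqxx.
Qed.

Lemma adj_bridges_set2 e : e \in bridges -> exists u v, adj u v /\ e = [set u; v].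
Proof.
rewrite inE => /existsP[u /existsP[v /andP[/andP[uv _] /eqP->]]].
by exists u, v.
Qed.

(** * Minimal spanning edge sets and edge exchange *)

Definition spanning E := [forall x, forall y, connect (span E) x y].

Lemma spanningP E : reflect (forall x y, connect (span E) x y) (spanning E).
Proof. by apply: (iffP forallP) => h x; apply/forallP. Qed.

(** An edge whose ends stay connected could be dropped from [T]. Minimal spanning sets thus act as
    spanning trees. *)
Lemma minset_spanning_separating T e :
  minset spanning T -> e \in T -> separating T e.
Proof.
move=> /minsetP[/spanningP Tsp Tmin] eT u v eE; apply/negP => uv.
have : spanning (T :\ e).
  apply/spanningP => x y; have := Tsp x y; apply: connect_sub => a b.
  case/andP=> ab abT; have [abE|abN] := eqVneq [set a; b] e.
    by rewrite (connect_set2 (connect_span_sym _) (etrans abE eE)).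
  by apply: connect1; rewrite /span ab !inE abN.
by move/Tmin => /(_ (subsetDl _ _)) TE; move: eT; rewrite -TE !inE eqxx.
Qed.

(* Edge exchange: [e] is replaced by an edge [ab] joining the two parts of [T :\ e]. *)
Lemma exchange_path T x p e : connected G ->
    minset spanning T -> path (span T) x p -> uniq (x :: p) ->
    e \in path_edges x p -> e \notin bridges ->
  exists q1 a b q2,
    [/\ simple_path x (last x p) (q1 ++ b :: q2), a = last x q1, [set a; b] \notin T,
        path (span T) x q1 & path (span T) b q2].
Proof.
move=> conG Tmin pP up ep eNb.
have Tsp := elimT (spanningP T) (minsetp Tmin).
have [u [v [eE /andP[uv uvT] xu vy]]] := path_span_split pP up ep.
have eT : e \in T by rewrite eE.
have sepe := minset_spanning_separating Tmin eT.
have xNy := path_separating pP up ep sepe.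
set y := last x p in vy xNy *.
pose r := span (T :\ e).
have rs : connect_sym r by exact: connect_span_sym.
have sub : subrel r (span (setT :\ e)).
  by move=> a b; rewrite /r /span !inE => /and3P[-> ->].
have xyG : connect (span (setT :\ e)) x y.
  have sub' := connect_sub (fun a b ab => connect1 (sub a b ab)).
  apply: connect_trans (sub' _ _ xu) (connect_trans _ (sub' _ _ vy)).
  by rewrite eE; apply: bridges_connect; rewrite -?eE.
(* G without the non-bridge [e] still joins x to y, so one of its edges leaves the component of x in
   [T :\ e]. *)
have [//|a [b [ab xa xb]]] := connect_crossing (A := connect r x) xyG (connect0 _ _).
rewrite !unfold_in in xa xb.
have abT : [set a; b] \notin T.
  apply: contra xb => abT; apply: connect_trans xa (connect1 _).
  by move: ab; rewrite /r /span !inE abT => /and3P[-> ->].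
(* The path in [T] from x to b must cross [e], and in the same direction as [p], so b lies on the
   side of y. *)
have yb : connect r b y.
  have [q [qP qb uq]] := connect_simple (Tsp x b).
  have [eq|eNq] := boolP (e \in path_edges x q); last first.
    case/negP: xb; apply/connectP; exists q => //.
    exact: path_span_del.
  have [u' [v' [eE' _ xu' v'b]]] := path_span_split qP uq eq.
  rewrite qb in v'b; rewrite rs; rewrite rs in vy.
  have [[_ vE]|[uE _]] := set2_eq (etrans (esym eE) eE').
    by apply: connect_trans vy _; rewrite vE.
  by case/negP: xb; apply: connect_trans xu _; rewrite uE.
have [q1 [q1P q1a uq1]] := connect_simple xa.
have [q2 [q2P q2y uq2]] := connect_simple yb.
have rT c q : path r c q -> path (span T) c q.
  by apply: sub_path => ? ?; rewrite /r /span !inE => /and3P[-> _ ->].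
exists q1, a, b, q2; split=> //; try exact: rT.
have radj c q : path r c q -> path (@adj G) c q.
  by apply: sub_path => ? ? /andP[].
split.
- rewrite cat_path /= q1a !radj //= andbT.
  by case/andP: ab.
- by rewrite last_cat.
(* [q1] and [q2] lie in different components of [T :\ e], hence are disjoint. *)
rewrite -cat_cons cat_uniq uq1 uq2 andbT; apply/hasPn => z zq2 /=.
apply: contra xb => zq1; apply: (connect_trans (y := z)).
  exact: (path_connect q1P).
by rewrite rs; apply: (path_connect q2P).
Qed.

(** * Two colors suffice *)

Lemma path_avoids_bridge x p q e : connected G -> e \in bridges ->
    path (@adj G) x p -> path (@adj G) x q -> last x p = last x q ->
  uniq (x :: q) -> e \notin path_edges x p -> e \notin path_edges x q.
Proof.
move=> conG eb pP qP pq uq eNp; apply/negP => eq.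
have toT s : path (@adj G) x s -> path (span setT) x s.
  by apply: sub_path => a b ab; rewrite /span ab inE.
(* A bridge on the simple path [q] separates its ends, but [p] joins them without it. *)
have := path_separating (toT _ qP) uq eq (bridges_separating conG eb).
rewrite -pq => /negP; apply; apply/connectP; exists p => //.
exact/path_span_del/eNp/toT.
Qed.

Lemma cfc_colorable_two e0 : connected G ->
    (forall e f, e \in bridges -> f \in bridges -> e != e0 -> f != e0 ->
       e != f -> [disjoint e & f]) ->
  cfc_colorable G 2.
Proof.
move=> conG matching.
have [T Tmin] : {T | minset spanning T}.
  by apply: ex_minset; exists setT; apply/spanningP => x y; apply: connect_setT.
have Tsp := elimT (spanningP T) (minsetp Tmin).
(* The test [e \in bridges] allows [e0] to be any set, such as [set0] when the bridges already form
   a matching. *)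
pose red e := (e \notin T) || (e \in bridges) && (e == e0).
exists (fun e => red e : nat); split=> [x y _|x y xNy]; first exact: leq_b1.
have [p [pP py up]] := connect_simple (Tsp x y).
have /andP[pG /allP pT] : path (@adj G) x p && all (mem T) (path_edges x p).
  by rewrite -path_span.
have redT e : e \in T -> red e = (e \in bridges) && (e == e0).
  by move=> eT; rewrite /red eT.
have count1 s : count (fun e => (red e : nat) == 1) s = count red s.
  by apply: eq_count => e; case: (red e).
(* All edges of [p] are in [T], so a bridge [e0] on it is its only red edge. *)
have [/andP[e0p e0b]|e0N] := boolP ((e0 \in path_edges x p) && (e0 \in bridges)).
  exists p => //; exists 1; rewrite count1.
  have -> : 1 = count_mem e0 (path_edges x p).
    by rewrite count_uniq_mem ?e0p //; apply: path_edges_uniq.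
  apply: eq_in_count => e /pT eT; rewrite redT //=.
  by case: eqP => [->|]; rewrite ?andbF ?e0b.
have [/allP allb|] := boolP (all (mem bridges) (path_edges x p)).
  exists p => //.
  case: p pP py up pG pT e0N allb => [_ xy|v [|w p]].
  - by move: xNy; rewrite -xy /= eqxx.
  - by move=> *; exists (red [set x; v] : nat); rewrite /= eqxx.
  (* Two consecutive bridges other than [e0] share [v], against the matching. *)
  move=> pP py up pG pT e0N allb.
  have b1 : [set x; v] \in bridges by apply: allb; rewrite inE eqxx.
  have b2 : [set v; w] \in bridges by apply: allb; rewrite !inE eqxx orbT.
  have N1 : [set x; v] != e0.
    by apply: contraNneq e0N => <-; rewrite b1 inE eqxx.
  have N2 : [set v; w] != e0.
    by apply: contraNneq e0N => <-; rewrite b2 !inE eqxx orbT.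
  have N12 : [set x; v] != [set v; w].
    by have := path_edges_uniq up; rewrite /= inE negb_or => /andP[/andP[]].
  have := matching _ _ b1 b2 N1 N2 N12; rewrite disjoint_subset => /subsetP/(_ v).
  by rewrite !inE eqxx orbT => /(_ isT).
(* A non-bridge of [p] is exchanged; the new edge [[set a; b]] is then the only red one. *)
case/allPn=> e ep eNb.
have [q1 [a [b [q2 [qS aE abT q1P q2P]]]]] := exchange_path conG Tmin pP up ep eNb.
exists (q1 ++ b :: q2); first by rewrite -py.
exists 1; rewrite count1 path_edges_cat count_cat /= -aE.
have [qG ql uq] := qS.
have e0q : e0 \in bridges -> e0 \notin path_edges x (q1 ++ b :: q2).
  move=> e0b; rewrite e0b andbT in e0N.
  exact: path_avoids_bridge e0b pG qG (esym ql) uq e0N.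
have no_red c s : path (span T) c s ->
    {subset path_edges c s <= path_edges x (q1 ++ b :: q2)} ->
    count red (path_edges c s) = 0.
  rewrite path_span => /andP[_ /allP sT] sq; apply/eqP.
  rewrite -leqn0 leqNgt -has_count; apply/hasPn => f fs; rewrite redT; last exact: sT.
  apply/andP => -[fb /eqP fE]; move: (e0q); rewrite -fE => /(_ fb).
  by rewrite sq.
rewrite (no_red x q1) // ?(no_red b q2) //.
- by rewrite /red abT.
- by move=> f fq; rewrite path_edges_cat /= mem_cat inE fq !orbT.
- by move=> f fq; rewrite path_edges_cat /= mem_cat fq.
Qed.

(** * At most three bridges *)

Lemma bridge_no_triangle a b c : connected G ->
  [set a; b] \in bridges -> adj a c -> adj c b -> False.
Proof.
move=> conG ab ac cb; have [u [v [uv eE]]] := adj_bridges_set2 ab.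
have abN : a != b.
  apply: contraTneq uv => abE; rewrite abE setUid in eE.
  have /set1P-> : u \in [set b] by rewrite eE set21.
  have /set1P-> : v \in [set b] by rewrite eE set22.
  by rewrite adj_irrefl.
have caN : c != a by apply: contraTneq ac => ->; rewrite adj_irrefl.
have cbN : c != b by apply: contraTneq cb => ->; rewrite adj_irrefl.
have cN : c \notin [set a; b] by rewrite !inE negb_or caN.
(* The detour through [c] joins the ends of the bridge without using it. *)
have /negP := bridges_separating conG ab erefl; apply.
apply: (connect_trans (y := c)); apply: connect1; rewrite /span ?ac ?cb !inE andbT /=.
  by apply: contraNneq cN => <-; rewrite set22.
by apply: contraNneq cN => <-; rewrite set21.
Qed.

Definition ends B v := #|[set e in B | v \in e]|.

Lemma sum_ends B : B \subset bridges -> \sum_v ends B v = 2 * #|B|.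
Proof.
move=> /subsetP sB.
under eq_bigr => v _ do rewrite /ends -sum1dep_card big_mkcondr.
rewrite exchange_big /= mulnC -sum_nat_const; apply: eq_bigr => e /sB eb.
rewrite -big_mkcond sum1_card; have [u [v [uv ->]]] := adj_bridges_set2 eb.
by rewrite cards2; case: eqP uv => // ->; rewrite adj_irrefl.
Qed.

Definition comp B v := [set w | connect (span (~: B)) v w].

(** Neighbors of w along edges outside [B] lie in its component and differ from w; the others inject
    into the edges of [B] at w. *)
Lemma deg_comp_ends B v w : w \in comp B v ->
  deg w < #|comp B v| + ends B w.
Proof.
rewrite inE => vw; rewrite (cardsD1 w) inE vw addSn ltnS.
have -> : deg w = #|[set y | span (~: B) w y]|
                + #|[set y | adj w y && ([set w; y] \in B)]|.
  rewrite /deg -(cardsID [set y | [set w; y] \in ~: B]); congr (_ + _).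
    by apply: eq_card => y; rewrite !inE /span inE.
  by apply: eq_card => y; rewrite !inE negbK andbC.
apply: leq_add.
  apply/subset_leq_card/subsetP => y; rewrite !inE => wy.
  rewrite (connect_trans vw (connect1 wy)) andbT.
  by apply: contraTneq wy => ->; rewrite /span adj_irrefl.
rewrite -(card_in_imset (f := fun y => [set w; y])); last first.
  move=> y z _; rewrite !inE => /andP[wz _] /set2_eq[[]//|[wE]].
  by rewrite wE adj_irrefl in wz.
apply/subset_leq_card/subsetP => e /imsetP[y]; rewrite !inE => /andP[_ yB] ->.
by rewrite yB set21.
Qed.

Notation apart B := (fun u v => ~~ connect (span (~: B)) u v).

Lemma count_apart B s w : pairwise (apart B) s ->
  count (fun r => connect (span (~: B)) r w) s <= 1.
Proof.
elim: s => //= r s IHs /andP[/allP rs /IHs sle].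
have [rw|_] //= := boolP (connect _ r w).
rewrite add1n ltnS leqn0 eqn0Ngt -has_count; apply/hasPn => t /rs /=.
apply: contra => tw; apply: connect_trans rw _.
by rewrite connect_span_sym.
Qed.

(** No vertex lies in two of the components, so after exchanging the sums each weight counts at most
    once. *)
Lemma sum_comp_apart B s (f : G -> nat) : pairwise (apart B) s ->
  \sum_(r <- s) \sum_(w in comp B r) f w <= \sum_w f w.
Proof.
move=> sP; under eq_bigr => r _ do rewrite big_mkcond /=.
rewrite exchange_big /=; apply: leq_sum => w _.
rewrite -big_mkcond big_const_seq iter_addn addn0 -[leqRHS]muln1 leq_mul2l.
rewrite (eq_count (a2 := fun r => connect (span (~: B)) r w)) => [|r]; last by rewrite inE.
by rewrite count_apart ?orbT.
Qed.

(** Induction on [B]: each removed bridge splits one component in two. *)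
Lemma bridges_apart B x0 : connected G -> B \subset bridges ->
  exists2 s, #|B| < size s & pairwise (apart B) s.
Proof.
move=> conG; have [m] := ubnP #|B|; elim: m B => // m IHm B Bm sB.
have [->|[e eB]] := set_0Vmem B; first by exists [:: x0]; rewrite ?cards0.
have [x [y [xy eE]]] := adj_bridges_set2 (subsetP sB e eB).
rewrite (cardsD1 e) eB add1n ltnS in Bm.
have [s sB' sP] := IHm (B :\ e) Bm (subset_trans (subsetDl _ _) sB).
pose r := span (~: (B :\ e)).
have rs : connect_sym r by exact: connect_span_sym.
have rxy : connect r x y.
  by apply: connect1; rewrite /r /span xy -eE !inE eqxx.
have mono u v : connect (span (~: B)) u v -> connect r u v.
  by apply: connect_span_mono; rewrite setCS subsetDl.
(* With [e] restored, x and y share a component, and at most one member of [s] lies in it. Both ends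
   replace that member, so the list grows. *)
exists [:: x, y & [seq u <- s | ~~ connect r u x]].
  rewrite (cardsD1 e) eB /= add1n !ltnS size_filter.
  rewrite -ltnS; apply: leq_trans sB' _; rewrite -(count_predC (connect r ^~ x)) -add1n.
  exact: leq_add (count_apart x sP) (leqnn _).
have /negP xyN := bridges_separating conG (subsetP sB e eB) eE.
have far z : connect r x z -> all (apart B z) [seq u <- s | ~~ connect r u x].
  move=> xz; apply/allP => u; rewrite mem_filter => /andP[ux _]; apply: contra ux => zu.
  by rewrite rs; apply: connect_trans xz (mono _ _ zu).
apply/and3P; split; [apply/andP; split; last exact/far/connect0 | exact: far |].
  apply/negP => cxy; apply: xyN; apply: connect_span_mono cxy.
  by apply/subsetP => f; rewrite !inE andbT; apply: contraNneq => ->.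
apply: (sub_pairwise (r := apart (B :\ e))); last exact: pairwise_filter.
by move=> u v; apply: contra; apply: mono.
Qed.

(** A path of G from v to w leaves the component through an edge of [B]. *)
Lemma comp_has_end B v w : connected G -> ~~ connect (span (~: B)) v w ->
  0 < \sum_(u in comp B v) ends B u.
Proof.
move=> conG vw; have [||a [b [ab va vb]]] := connect_crossing (A := comp B v) (conG v w).
- by rewrite inE.
- by rewrite inE.
have abB : [set a; b] \in B.
  apply: contraR vb => abB; rewrite inE in va; rewrite inE.
  by apply: connect_trans va (connect1 _); rewrite /span ab inE.
rewrite (bigD1 a) //= ltn_addr //; apply/card_gt0P; exists [set a; b].
by rewrite inE abB set21.
Qed.

Definition comp_rep B r := [arg min_(v < r | connect (span (~: B)) r v) ends B v].

(* If every vertex of C carries at least b >= 1 ends, the minimum being attained at v,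
   then deg v <= |C| - 1 + b <= |C| * b. *)
Lemma comp_repP B r (v := comp_rep B r) (C := comp B r) :
  connect (span (~: B)) r v /\
  if ends B v == 0 then deg v < #|C| else deg v <= \sum_(w in C) ends B w.
Proof.
rewrite /v /comp_rep; case: arg_minnP => [|{}v rv vmin]; first exact: connect0.
split=> //; have vC : v \in C by rewrite inE.
have degv := deg_comp_ends vC.
case: eqP degv => [->|/eqP]; first by rewrite addn0.
rewrite -lt0n -/C => b0 degv.
have le : #|C| * ends B v <= \sum_(w in C) ends B w.
  by rewrite -sum_nat_const; apply: leq_sum => w; rewrite inE => /vmin.
have : 0 < #|C| by apply/card_gt0P; exists v.
nia.
Qed.

Lemma card_bridges_le3 : connected G -> 33 <= #|G| ->
    (forall x y, x != y -> ~~ adj x y -> 2 * #|G| <= 5 * (deg x + deg y) + 9) ->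
  #|bridges| <= 3.
Proof.
move=> conG n33 degG; rewrite leqNgt; apply/negP => b4.
(* Taking exactly four bridges fixes the total number of ends at eight. *)
have [B sB cardB] : exists2 B : {set {set G}}, B \subset bridges & #|B| = 4.
  exists [set e in take 4 (enum bridges)].
    by apply/subsetP => e; rewrite inE => /mem_take; rewrite mem_enum.
  rewrite cardsE (card_uniqP _) ?take_uniq ?enum_uniq //.
  by rewrite size_takel // -cardE.
have [x0 _] : exists x0 : G, x0 \in G by apply/card_gt0P; apply: leq_trans n33.
have [s] := bridges_apart x0 conG sB; rewrite cardB.
case: s => [|r1 [|r2 [|r3 [|r4 [|r5 s]]]]] // _.
rewrite -[_ :: _]/([:: r1; r2; r3; r4; r5] ++ s) pairwise_cat => /and3P[_ sP _].
pose v := comp_rep B; pose t r := \sum_(w in comp B r) ends B w.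
have sumk : \sum_(r <- [:: r1; r2; r3; r4; r5]) #|comp B r| <= #|G|.
  have := sum_comp_apart (fun _ => 1) sP; rewrite sum1_card.
  by under eq_bigr => r _ do rewrite sum1_card.
have sumt := sum_comp_apart (ends B) sP.
rewrite sum_ends // cardB in sumt.
have P r : if ends B (v r) == 0 then deg (v r) < #|comp B r| else deg (v r) <= t r.
  by have [] := comp_repP B r.
have apv r r' : apart B r r' -> apart B (v r) (v r').
  have [rv _] := comp_repP B r; have [rv' _] := comp_repP B r'.
  apply: contra => vv'; apply: connect_trans rv (connect_trans vv' _).
  by rewrite connect_span_sym.
have adjB a b : apart B a b -> adj a b -> [set a; b] \in B.
  by move=> abN ab; apply: contraR abN => N; apply: connect1; rewrite /span ab inE.
pose ok r r' := 2 * #|G| <= 5 * (deg (v r) + deg (v r')) + 9.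
have okN r r' : apart B r r' -> ~~ adj (v r) (v r') -> ok r r'.
  move=> /apv ap; apply: degG; apply: contraNneq ap => ->; exact: connect0.
(* Representatives of different parts are adjacent only through an edge of [B], which gives each of
   them an end. *)
have ok2 r r' : apart B r r' -> (ends B (v r) == 0) || (ends B (v r') == 0) -> ok r r'.
  move=> ap z; apply: okN => //; apply: contraL z => /(adjB _ _ (apv _ _ ap)) vB.
  rewrite negb_or -!lt0n; apply/andP; split; apply/card_gt0P; exists [set v r; v r'].
    by rewrite inE vB set21.
  by rewrite inE vB set22.
(* Three pairwise adjacent representatives would form a triangle containing a bridge. *)
have ok3 a b c : apart B a b -> apart B b c -> apart B a c -> [|| ok a b, ok b c | ok a c].
  move=> ab bc ac; rewrite -[_ || _]negbK !negb_or; apply/negP => /and3P[Nab Nbc Nac].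
  have adjv r r' : apart B r r' -> ~~ ok r r' -> adj (v r) (v r').
    by move=> ap; apply: contraR; apply: okN.
  have acB : [set v a; v c] \in bridges.
    by apply: (subsetP sB); apply: adjB; [apply: apv|apply: adjv].
  exact: bridge_no_triangle conG acB (adjv _ _ ab Nab) (adjv _ _ bc Nbc).
pose r i := nth r1 [:: r1; r2; r3; r4; r5] i.
have apr i j : i < j < 5 -> apart B (r i) (r j).
  move=> /andP[ij j5]; apply: (elimT (pairwiseP r1) sP) => //.
  exact: ltn_trans ij j5.
rewrite !big_cons !big_nil in sumk sumt.
apply: (@five_parts #|G| (fun i => #|comp B (r i)|) (fun i => deg (v (r i)))
  (fun i => t (r i)) (fun i => ends B (v (r i)) == 0)) => //.
- by move=> i _; apply/card_gt0P; exists (r i); rewrite inE connect0.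
- case=> [|i] i5; first exact: comp_has_end (apr 0 1 isT).
  apply: (comp_has_end (w := r 0)) => //.
  by rewrite connect_span_sym; apply: apr.
- by move=> i j ij; apply: ok2; apply: apr.
move=> i j l /andP[ij jl] l5; apply: ok3; apply: apr; apply/andP; split=> //.
- exact: ltn_trans jl l5.
- exact: ltn_trans ij jl.
Qed.

(** * Matchings among at most three bridges *)

Lemma bridges_end e a : e \in bridges -> a \in e ->
  exists2 b, cut_edge a b & e = [set a; b].
Proof.
rewrite inE => /existsP[u /existsP[v /andP[uv /eqP->]]] /set2P[]->.
  by exists v.
by exists u; rewrite 1?cut_edge_sym // setUC.
Qed.

Hypothesis conG : connected G.
Hypothesis no_star : forall v a b c, cut_edge v a -> cut_edge v b -> cut_edge v c ->
  [|| a == b, b == c | a == c].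

(** Three pairwise meeting edges form a star or a triangle; [no_star] excludes the former,
    [bridge_no_triangle] the latter. *)
Lemma bridges_not_pairwise_meeting e f g :
    e \in bridges -> f \in bridges -> g \in bridges ->
    e != f -> f != g -> e != g ->
  ~~ [disjoint e & f] -> ~~ [disjoint f & g] -> [disjoint e & g].
Proof.
move=> eb fb gb ef fg eg /pred0Pn[a /andP[/= ae af]] /pred0Pn[y /andP[/= yf yg]].
apply/negPn/negP => /pred0Pn[x /andP[/= xe xg]].
have [b ab eE] := bridges_end eb ae; have [c ac fE] := bridges_end fb af.
have bc : b != c by apply: contra_neq ef => bc; rewrite eE fE bc.
have [ag|aNg] := boolP (a \in g).
  have [d ad gE] := bridges_end gb ag.
  have /or3P[] := no_star ab ac ad; first by rewrite (negPf bc).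
    by move/eqP=> cd; rewrite fE gE cd eqxx in fg.
  by move/eqP=> bd; rewrite eE gE bd eqxx in eg.
have xb : x = b.
  by move: xe; rewrite eE => /set2P[xa|//]; rewrite -xa xg in aNg.
have yc : y = c.
  by move: yf; rewrite fE => /set2P[ya|//]; rewrite -ya yg in aNg.
rewrite xb in xg; rewrite yc in yg.
have [d _ gE] := bridges_end gb xg.
have cd : c = d by move: yg; rewrite gE => /set2P[cb|//]; rewrite cb eqxx in bc.
rewrite -cd in gE; rewrite gE in gb.
apply: (bridge_no_triangle (c := a) conG gb); last by case/andP: ac.
by rewrite adj_sym; case/andP: ab.
Qed.

Lemma bridges_matching_off_one : #|bridges| <= 3 ->
  exists e0, forall e f, e \in bridges -> f \in bridges -> e != e0 -> f != e0 ->
    e != f -> [disjoint e & f].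
Proof.
move=> b3; pose meet e f := (e != f) && ~~ [disjoint e & f].
have [|none] := boolP [exists e in bridges, exists f in bridges, meet e f]; last first.
  exists set0 => e f eb fb _ _ ef; apply: contraR none => N.
  apply/existsP; exists e; rewrite eb; apply/existsP; exists f.
  by rewrite fb /meet ef.
case/existsP=> e /andP[eb /existsP[f /andP[fb /andP[ef efN]]]].
have third g h : g \in bridges -> h \in bridges -> g != e -> g != f ->
    h != e -> h != f -> g = h.
  move=> gb hb ge gf he hf; apply/eqP; apply: contraLR b3 => gh; rewrite -ltnNge.
  have <- : size [:: e; f; g; h] = 4 by [].
  rewrite cardE uniq_leq_size //.
    by rewrite /= !inE !negb_or ef gh ![e == _]eq_sym ![f == _]eq_sym ge gf he hf.
  by move=> k; rewrite mem_enum !in_cons in_nil orbF => /or4P[] /eqP->.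
have [|none] := boolP [exists g in bridges, [&& g != e, g != f & ~~ [disjoint e & g]]].
  case/existsP=> g /and4P[gb ge gf egN].
  have fg : [disjoint f & g].
    by apply: (bridges_not_pairwise_meeting (f := e)); rewrite // 1?eq_sym // disjoint_sym.
  (* [e] is the middle edge: it meets [f] and [g], which are disjoint. *)
  exists e => e' f' e'b f'b e'e f'e e'f'.
  have [e'f|e'f] := eqVneq e' f.
    rewrite e'f (third f' g) // -e'f eq_sym //.
  have [f'f|f'f] := eqVneq f' f.
    by rewrite f'f (third e' g) // disjoint_sym.
  by rewrite (third e' f') ?eqxx in e'f'.
have none' g : g \in bridges -> g != e -> g != f -> [disjoint e & g].
  move=> gb ge gf; apply: contraR none => N; apply/existsP; exists g.
  by rewrite gb ge gf.
(* Only [f] meets [e], so without [f] a possible third bridge is disjoint from [e]. *)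
exists f => e' f' e'b f'b e'f f'f e'f'.
have [e'e|e'e] := eqVneq e' e.
  by rewrite e'e none' // -e'e eq_sym.
have [f'e|f'e] := eqVneq f' e.
  by rewrite f'e disjoint_sym none'.
by rewrite (third e' f') ?eqxx in e'f'.
Qed.

End SpanningSubgraphs.

(** * Linear forests, the lower bound and the conclusion *)

Lemma component_is_path_no_star (H : sgraph) (x a b c : H) : component_is_path x ->
  adj x a -> adj x b -> adj x c -> [|| a == b, b == c | a == c].
Proof.
case=> s [us sE sadj] xa xb xc.
have xs : x \in s by rewrite sE; apply: connect0.
have idx y : adj x y ->
    y \in s /\ (index y s == (index x s).+1) || (index x s == (index y s).+1).
  move=> xy; have ys : y \in s by rewrite sE; apply: connect1.
  by split=> //; rewrite -sadj ?index_mem // !nth_index.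
have [ains ia] := idx a xa; have [bs ib] := idx b xb; have [cs ic] := idx c xc.
(* Neighbors of x occupy only the two positions next to x, so two of the three coincide. *)
have : [|| index a s == index b s, index b s == index c s | index a s == index c s].
  lia.
have inj y z : y \in s -> z \in s -> (index y s == index z s) = (y == z).
  move=> ys zs; apply/eqP/eqP => [yz|->] //.
  by rewrite -(nth_index x ys) yz nth_index.
by rewrite !inj.
Qed.

Lemma linear_forest_no_star (G : sgraph) (v a b c : G) :
    linear_forest (cut_edge_graph G) ->
    cut_edge v a -> cut_edge v b -> cut_edge v c ->
  [|| a == b, b == c | a == c].
Proof.
case=> _ lf va vb vc.
have cutP y : cut_edge v y -> [exists z, cut_edge y z].
  by move=> vy; apply/existsP; exists v; rewrite cut_edge_sym.
have vP : [exists y, cut_edge v y] by apply/existsP; exists a.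
pose V : cut_edge_graph G := Sub v vP.
pose A : cut_edge_graph G := Sub a (cutP a va).
pose B : cut_edge_graph G := Sub b (cutP b vb).
pose C : cut_edge_graph G := Sub c (cutP c vc).
have := @component_is_path_no_star _ V A B C (lf V) va vb vc.
by rewrite -!(inj_eq val_inj).
Qed.

(** With at most one color, a color occurs exactly once on a path only if the path is a single
    edge. *)
Lemma cfc_colorable_one_complete (G : sgraph) (k : nat) :
  k <= 1 -> cfc_colorable G k -> complete G.
Proof.
move=> k1 [c [ck cfc]] x y xy; have [p [pP py _] [a]] := cfc x y xy.
have c0 u q : path (@adj G) u q -> all (fun e => c e == 0) (path_edges u q).
  elim: q u => //= w q IHq u /andP[uw /IHq->]; rewrite andbT.
  by rewrite -leqn0 -ltnS (leq_trans (ck _ _ uw)).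
have -> : count (fun e => c e == a) (path_edges x p) = (a == 0) * size p.
  rewrite -(size_pairmap (fun u v => [set u; v]) x p) -/(path_edges x p).
  elim: (path_edges x p) (c0 _ _ pP) => [|e s IHs] /=; first by rewrite muln0.
  by case/andP=> /eqP-> /IHs->; rewrite eq_sym; case: (a == 0).
case: eqP => // _; rewrite mul1n; case: p pP py => [|w []] //= /andP[xw _] <- _.
exact: xw.
Qed.

Theorem theorem4p5 (G : sgraph) (n : nat)
    (order_G : #|G| = n) (n_ge33 : 33 <= n)
    (conn_G : connected G) (noncomplete_G : ~ complete G)
    (lf_CG : linear_forest (cut_edge_graph G))
    (deg_sum : forall x y : G, x != y -> ~~ adj x y ->
       ((2 * n%:R - 9) / 5 <= (deg x + deg y)%:R :> rat)%R) :
  cfc_eq G 2.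
Proof.
split=> [|j colj]; last first.
  by rewrite ltnNge; apply/negP => /cfc_colorable_one_complete/(_ colj).
(* Clearing the denominator and moving 9 to the right avoids truncated subtraction in [nat]. *)
have deg_sum' (x y : G) : x != y -> ~~ adj x y -> 2 * #|G| <= 5 * (deg x + deg y) + 9.
  move=> xy Nxy; rewrite order_G -(@Num.Theory.ler_nat rat).
  have := deg_sum x y xy Nxy.
  rewrite !(GRing.natrD, GRing.natrM); lra.
have [||e0 e0P] := @bridges_matching_off_one G conn_G.
- by move=> v a b c; apply: linear_forest_no_star.
- by apply: card_bridges_le3 deg_sum'; rewrite ?order_G.
exact: cfc_colorable_two e0P.
Qed.
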